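(* Let $n\ge 1$, let $B=(b_{ij})$ be a real $n\times n$ matrix with $b_{ij}\ge 0$ for all $i,j$ and $b_{ii}=0$, let $c\in\mathbb{R}^n$ and $X\subseteq\{0,1\}^n$. Let $\overline{X}$ satisfy $X\subseteq\overline{X}\subseteq[0,1]^n$, and for $i=1,\dots,n$ let $u_i=\max\{\sum_{j\neq i}b_{ij}x_j : x\in\overline{X}\}$, $v_i=\max\{\sum_{j\neq i}b_{ij}x_j : x\in\overline{X},\ x_i=0\}$, $l_i=\min\{\sum_{j\neq i}b_{ij}x_j : x\in\overline{X},\ x_i=1\}$. Let $v(\textnormal{R-PL}_1)$ be the optimal (infimum) value of: minimize $\sum_{i=1}^n (y_i+c_ix_i)$ over $(x,y)\in\overline{X}\times\mathbb{R}^n$ subject to $y_i\ge\sum_{j\neq i}b_{ij}x_j+u_ix_i-u_i$, $y_i\ge 0$ ($i=1,\dots,n$); and let $v(\textnormal{R-PL}_2)$ be the optimal (infimum) value of: minimize $\sum_{i=1}^n (y_i+c_ix_i)$ over $(x,y)\in\overline{X}\times\mathbb{R}^n$ subject to $y_i\ge\sum_{j\neq i}b_{ij}x_j+v_ix_i-v_i$, $y_i\ge l_ix_i$ ($i=1,\dots,n$). Then $v(\textnormal{R-PL}_1)\le v(\textnormal{R-PL}_2)$.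
   Context: These are the continuous relaxations (replacing $X$ by $\overline{X}$) of two mixed 0-1 linearizations of $\min\{x^TBx+c^Tx: x\in X\}$. $\overline{X}$ is a relaxation of $X$; it is assumed that for each $i$ the sets $\{x\in\overline{X}: x_i=0\}$ and $\{x\in\overline{X}: x_i=1\}$ are nonempty and all maxima and minima defining $u_i,v_i,l_i$ are attained. *)

(* Defs.v *)
From HB Require Import structures.
From mathcomp Require Import all_boot all_order all_algebra.
From mathcomp Require Import classical_sets reals ereal.

Set Implicit Arguments.
Unset Strict Implicit.
Unset Printing Implicit Defensive.

Import Order.TTheory GRing.Theory Num.Theory.

Local Open Scope classical_set_scope.
Local Open Scope ring_scope.

(* [is_max A m] says that the maximum of A exists, is attained, and equals m;
   in particular it entails that A is nonempty. Likewise for [is_min]. *)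
Definition is_max (R : realType) (A : set R) (m : R) : Prop :=
  A m /\ ubound A m.

Definition is_min (R : realType) (A : set R) (m : R) : Prop :=
  A m /\ lbound A m.

Definition binary_vectors (R : realType) (n : nat) : set 'cV[R]_n :=
  [set x : 'cV[R]_n | forall i, x i 0 = 0 \/ x i 0 = 1].

Definition unit_box (R : realType) (n : nat) : set 'cV[R]_n :=
  [set x : 'cV[R]_n | forall i, 0 <= x i 0 <= 1].

Definition offdiag_row (R : realType) (n : nat) (B : 'M[R]_n) (i : 'I_n)
    (x : 'cV[R]_n) : R :=
  \sum_(j < n | j != i) B i j * x j 0.

Definition lin_objective (R : realType) (n : nat) (c x y : 'cV[R]_n) : R :=
  \sum_(i < n) (y i 0 + c i 0 * x i 0).

Definition feasible_PL1 (R : realType) (n : nat) (B : 'M[R]_n)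
    (D : set 'cV[R]_n) (u : 'cV[R]_n) : set ('cV[R]_n * 'cV[R]_n) :=
  [set p : 'cV[R]_n * 'cV[R]_n | D p.1 /\ forall i,
     p.2 i 0 >= offdiag_row B i p.1 + u i 0 * p.1 i 0 - u i 0 /\
     p.2 i 0 >= 0].

Definition feasible_PL2 (R : realType) (n : nat) (B : 'M[R]_n)
    (D : set 'cV[R]_n) (v l : 'cV[R]_n) : set ('cV[R]_n * 'cV[R]_n) :=
  [set p : 'cV[R]_n * 'cV[R]_n | D p.1 /\ forall i,
     p.2 i 0 >= offdiag_row B i p.1 + v i 0 * p.1 i 0 - v i 0 /\
     p.2 i 0 >= l i 0 * p.1 i 0].

(* The infimum is taken in the extended reals, so that no convention is needed
   for an infeasible or unbounded problem. *)
Definition lin_value (R : realType) (n : nat) (c : 'cV[R]_n)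
    (F : set ('cV[R]_n * 'cV[R]_n)) : \bar R :=
  ereal_inf [set (lin_objective c p.1 p.2)%:E | p in F].

Definition value_PL1 (R : realType) (n : nat) (B : 'M[R]_n) (c : 'cV[R]_n)
    (D : set 'cV[R]_n) (u : 'cV[R]_n) : \bar R :=
  lin_value c (feasible_PL1 B D u).

Definition value_PL2 (R : realType) (n : nat) (B : 'M[R]_n) (c : 'cV[R]_n)
    (D : set 'cV[R]_n) (v l : 'cV[R]_n) : \bar R :=
  lin_value c (feasible_PL2 B D v l).

(* Main.v *)
(* Every feasible point of R-PL2 is feasible for R-PL1: [v_i <= u_i] and
   [x_i <= 1] give [u_i (x_i - 1) <= v_i (x_i - 1)], and [l_i x_i >= 0]. *)
Require Import Defs.
From HB Require Import structures.
From mathcomp Require Import all_boot all_order all_algebra.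
From mathcomp Require Import classical_sets reals ereal.
From mathcomp Require Import ring.

Set Implicit Arguments.
Unset Strict Implicit.
Unset Printing Implicit Defensive.

Import Order.TTheory GRing.Theory Num.Theory.

Local Open Scope classical_set_scope.
Local Open Scope ring_scope.

(** The two problems share their objective, so [le_lin_value] reduces the claim to the inclusion of
    feasible sets, [feasible_PL2_sub_PL1]. That inclusion needs [v_i <= u_i], true since [v_i] is a
    maximum over a smaller set, and [l_i >= 0], true since [B] and the points of the box are
    nonnegative. *)

Lemma offdiag_row_ge0 (R : realType) (n : nat) (B : 'M[R]_n) (i : 'I_n)
    (x : 'cV[R]_n) :
  (forall i j, 0 <= B i j) -> unit_box x -> 0 <= offdiag_row B i x.
Proof.
move=> B_ge0 box_x; apply: sumr_ge0 => j _.
by apply: mulr_ge0 => //; have /andP[] := box_x j.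
Qed.

Lemma le_lin_value (R : realType) (n : nat) (c : 'cV[R]_n)
    (F G : set ('cV[R]_n * 'cV[R]_n)) :
  G `<=` F -> (lin_value c F <= lin_value c G)%E.
Proof. by move=> GF; apply: ereal_inf_le_tmp; apply: image_subset. Qed.

Lemma feasible_PL2_sub_PL1 (R : realType) (n : nat) (B : 'M[R]_n)
    (D : set 'cV[R]_n) (u v l : 'cV[R]_n) :
  D `<=` @unit_box R n -> (forall i, v i 0 <= u i 0) ->
  (forall i, 0 <= l i 0) -> feasible_PL2 B D v l `<=` feasible_PL1 B D u.
Proof.
move=> D_box le_vu l_ge0 [x y] [/= Dx xy]; split=> // i /=.
have [yv yl] := xy i; have /andP[x_ge0 x_le1] := D_box _ Dx i.
split; last by apply: le_trans yl; apply: mulr_ge0.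
apply: le_trans yv; rewrite -!addrA lerD2l -subr_ge0.
(* The gap between the two lower bounds on [y_i] factors into two nonnegative terms. *)
have -> : v i 0 * x i 0 - v i 0 - (u i 0 * x i 0 - u i 0)
        = (u i 0 - v i 0) * (1 - x i 0) by ring.
by apply: mulr_ge0; rewrite subr_ge0.
Qed.

Theorem theorem4 (R : realType) (n : nat) (hn : (1 <= n)%N)
    (B : 'M[R]_n) (hB : forall i j, 0 <= B i j) (hBdiag : forall i, B i i = 0)
    (c : 'cV[R]_n)
    (X Xbar : set 'cV[R]_n)
    (hX : X `<=` @binary_vectors R n)
    (hXXbar : X `<=` Xbar)
    (hXbar : Xbar `<=` @unit_box R n)
    (u v l : 'cV[R]_n)
    (hu : forall i, is_max [set offdiag_row B i x | x in Xbar] (u i 0))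
    (hv : forall i,
       is_max [set offdiag_row B i x | x in [set x : 'cV[R]_n | Xbar x /\ x i 0 = 0]]
         (v i 0))
    (hl : forall i,
       is_min [set offdiag_row B i x | x in [set x : 'cV[R]_n | Xbar x /\ x i 0 = 1]]
         (l i 0)) :
  (value_PL1 B c Xbar u <= value_PL2 B c Xbar v l)%E.
Proof.
apply/le_lin_value/feasible_PL2_sub_PL1 => // i.
(* A maximizer for [v_i] lies in [Xbar], so its value is bounded by [u_i]. *)
- have [[x [Xx _] <-] _] := hv i; have [_ u_ub] := hu i.
  by apply: u_ub; exists x.
(* Attainment makes [l_i] a row sum at a point of the box. *)
- have [[x [Xx _] <-] _] := hl i.
  by apply: offdiag_row_ge0 => //; apply: hXbar.
Qed.
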